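(* The models $IBME$ and $FIBME$ are equivalent: $\mathrm{Proj}_{nr}(XIBME)=\mathrm{Proj}_{nr}(XFIBME)$.
   Context: $N$ is a finite set of zones, $CNE$ a finite set of critical network elements, $PTDF_{k,z}\in\mathbb{R}$ ($k\in CNE$, $z\in N$) and $\widetilde F_k\in\mathbb{R}$ ($k\in CNE$) are given parameters. $\mathrm{Proj}_{nr}$ denotes projection on the variables $nr=(nr_z)_{z\in N}\in\mathbb{R}^N$. The models $IBME$ and $FIBME$ have the same objective, the same order-book variables and the same order-book constraints and differ only in that $nr$ is required to lie in $\mathrm{Proj}_{nr}(XIBME)$, respectively $\mathrm{Proj}_{nr}(XFIBME)$. For $l\in N$ let $V^l=\{v\in\mathbb{R}^N: v_l=-1,\ v_z\ge0\ \forall z\ne l,\ \sum_{z\in N}v_z=0\}$. $XIBME$ is the set of pairs $(nr,f)$, where $nr\in\mathbb{R}^N$ and $f=(f_{v^l})_{l\in N,\,v^l\in V^l}$ is a family of real numbers with only finitely many non-zero elements, such that $nr=\sum_{l\in N}\sum_{v^l\in V^l} f_{v^l}\,v^l$; $\sum_{l\in N}\sum_{v^l\in V^l}\max\big(0,\sum_{z\in N}PTDF_{k,z}v^l_z\big)f_{v^l}\le\widetilde F_k$ for all $k\in CNE$; $f\ge0$. $XFIBME$ is the set of tuples of real numbers $\big((nr_z)_{z\in N},(nr^l_z)_{l,z\in N},(w^l_k)_{l\in N,k\in CNE}\big)$ such that $nr_z=\sum_{l\in N}nr^l_z$ for all $z\in N$; $\sum_{z\in N}nr^l_z=0$ for all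 $l\in N$; $\sum_{z\in N}PTDF_{k,z}\,nr^l_z\le w^l_k$ for all $l\in N,k\in CNE$; $\sum_{l\in N}w^l_k\le\widetilde F_k$ for all $k\in CNE$; $nr^l_l\le0$ and $nr^l_z\ge0$ for $z\ne l$, for all $l\in N$; $w\ge0$. *)

(* Defs.v *)
From mathcomp Require Import all_boot all_order all_algebra.
From mathcomp Require Import boolp classical_sets functions cardinality fsbigop reals.

Set Implicit Arguments.
Unset Strict Implicit.
Unset Printing Implicit Defensive.
Import Order.TTheory GRing.Theory Num.Theory.
Local Open Scope classical_set_scope.
Local Open Scope ring_scope.

Section FlowBased.
Variables (R : realType) (N CNE : finType).
Variables (PTDF : CNE -> N -> R) (F : CNE -> R).

Definition V (l : N) : set {ffun N -> R} :=
  [set v : {ffun N -> R} |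
   [/\ v l = -1, forall z, z != l -> 0 <= v z & \sum_z v z = 0]].

(* [V l] is in general infinite, so the sums over it are the finitely supported
   sums of fsbigop; they are genuine sums because of the first clause (without
   it such a sum would default to 0). *)
Definition XIBME : set ({ffun N -> R} * (forall l : N, V l -> R)) :=
  [set x : {ffun N -> R} * (forall l : N, V l -> R) | let: (nr, f) := x in
   [/\ finite_set [set i : {l : N & V l} | f (tag i) (tagged i) != 0],
       forall z, nr z = \sum_l \sum_(v \in [set: V l]) f l v * val v z,
       forall k, \sum_l \sum_(v \in [set: V l])
                   Num.max 0 (\sum_z PTDF k z * val v z) * f l v <= F k
     & forall l v, 0 <= f l v]].

(* In a point [(nr, (nrl, w))], [nrl l z] is the variable nr^l_z and [w l k]
   is w^l_k. *)
Definition XFIBME :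
    set ({ffun N -> R} * ((N -> N -> R) * (N -> CNE -> R))) :=
  [set x : {ffun N -> R} * ((N -> N -> R) * (N -> CNE -> R)) |
   let: (nr, (nrl, w)) := x in
   [/\ forall z, nr z = \sum_l nrl l z,
       forall l, \sum_z nrl l z = 0,
       forall l k, \sum_z PTDF k z * nrl l z <= w l k,
       forall k, \sum_l w l k <= F k
     & (forall l, nrl l l <= 0 /\ forall z, z != l -> 0 <= nrl l z) /\
       (forall l k, 0 <= w l k)]].

Definition Proj_nr (Y : Type) (X : set ({ffun N -> R} * Y)) :
  set {ffun N -> R} := fst @` X.

(* A market model over order-book variables ranging over [B]: its solutions are
   pairs of an order-book vector and a net position vector. *)
Record model (B : Type) := Model {
  objective : B * {ffun N -> R} -> R ;
  feasible : set (B * {ffun N -> R}) }.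

Definition equivalent_models (B : Type) (M1 M2 : model B) : Prop :=
  objective M1 =1 objective M2 /\ feasible M1 = feasible M2.

Section Models.
Variables (B : Type) (obj : B * {ffun N -> R} -> R)
  (orderbook : set (B * {ffun N -> R})).

Definition IBME : model B :=
  Model obj (orderbook `&` [set s | Proj_nr XIBME s.2]).

Definition FIBME : model B :=
  Model obj (orderbook `&` [set s | Proj_nr XFIBME s.2]).
End Models.

End FlowBased.

(* Main.v *)
Require Import Defs.
From mathcomp Require Import all_boot all_order all_algebra.
From mathcomp Require Import boolp classical_sets functions cardinality fsbigop reals.

(** For each zone [l], the vectors [x] with [x l <= 0], the other entries
    nonnegative and total zero form a cone, and [V l] is the slice [x l = -1]
    of that cone.  Every nonzero vector of the cone has [x l < 0], so the ray
    through it meets [V l] in exactly one point: the cone consists of zero and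
    the positive multiples of elements of [V l], and equally of the finite
    nonnegative combinations of these elements.

    Hence the variables [nr^l] describe the same vectors as the combinations
    [\sum_v f l v * v], and only the capacity constraints have to be compared.
    A family [f] yields [w l k], the capacity that it uses on [k]; since each
    [max 0 (PTDF_k . v)] dominates [PTDF_k . v], this [w] dominates the flow of
    [nr^l] on [k] ([flow_combination_le]).  Conversely, the whole of [nr^l] is put
    on the single element of [V l] on its ray.  As [max 0] commutes with
    nonnegative scaling, the capacity used is then [max 0 (PTDF_k . nr^l)],
    the least value that the constraints on [w l k] permit
    ([exchange_cone_ray]).

    Both models see the network only through the projection on [nr], so their
    equivalence is the equality of the two projections. *)

Set Implicit Arguments.
Unset Strict Implicit.
Unset Printing Implicit Defensive.
Import Order.TTheory GRing.Theory Num.Theory.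
Local Open Scope classical_set_scope.
Local Open Scope ring_scope.

(** A sum over an infinite set is additive only under a finiteness condition;
    a common enumeration [s] of the support turns all the sums weighted by [f]
    into ordinary sums over a sequence at once. *)
Lemma weighted_fsum_seq (R : realType) (T : choiceType) (f : T -> R) :
  finite_set [set v | f v != 0] ->
  exists s : seq T, forall g : T -> R,
    \sum_(v \in [set: T]) f v * g v = \sum_(v <- s) f v * g v.
Proof.
move=> /finite_fsetP[X suppf]; exists (finmap.enum_fset X) => g; apply: fsbigTE => v vX.
have [->|fv0] := eqVneq (f v) 0; first by rewrite mul0r.
have : [set v | f v != 0] v by [].
by rewrite suppf /= (negPf vX).
Qed.

Lemma finite_set_sigT (N : finType) (T : N -> choiceType)
    (P : forall l, T l -> Prop) :
  finite_set [set i : {l : N & T l} | P (tag i) (tagged i)] <->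
  (forall l, finite_set [set v | P l v]).
Proof.
split=> [fin l|fin].
  apply: (finite_preimage (f := fun v : T l => Tagged T v) _ fin).
  by move=> u v _ _ /eqP; rewrite eq_Tagged => /eqP.
have fin_union : finite_set
    (\bigcup_(l in [set: N]) ((fun v : T l => Tagged T v) @` [set v | P l v])).
  by apply: bigcup_finite => // l _; apply: finite_image.
by apply: sub_finite_set fin_union => -[l v] Pv; exists l => //; exists v.
Qed.

Section ExchangeCone.
Variables (R : realType) (N : finType).
Implicit Types (l : N) (x c : N -> R).

Definition exchange_cone l : set (N -> R) :=
  [set x | [/\ x l <= 0, forall z, z != l -> 0 <= x z & \sum_z x z = 0]].

Lemma exchange_cone_eq0 l x : exchange_cone l x -> x l = 0 -> forall z, x z = 0.
Proof.
case=> _ xge0 sumx xl0 z.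
have {}xge0 y : 0 <= x y by have [->|/xge0//] := eqVneq y l; rewrite xl0.
by apply/eqP; move/eqP: sumx; rewrite psumr_eq0// => /allP/(_ z); apply;
   rewrite mem_index_enum.
Qed.

Lemma exchange_cone_normalize l x :
  exchange_cone l x -> x l != 0 -> V l [ffun z => x z / - x l].
Proof.
case=> xl_le0 xge0 sumx xl0; split=> [|z zl|].
- by rewrite ffunE invrN mulrN divff.
- by rewrite ffunE divr_ge0 ?xge0// oppr_ge0.
- by under eq_bigr do rewrite ffunE; rewrite -mulr_suml sumx mul0r.
Qed.

(** What recovers a family [f] from [nr^l], one zone at a time: concentrating
    the weight on one ray avoids cancellation between flows of opposite signs,
    so that the capacity used is no more than the positive part of the flow. *)
Lemma exchange_cone_ray l x : exchange_cone l x ->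
  exists f : @V R N l -> R,
    [/\ finite_set [set v | f v != 0],
        forall z, \sum_(v \in [set: @V R N l]) f v * val v z = x z,
        forall c, \sum_(v \in [set: @V R N l])
                    Num.max 0 (\sum_z c z * val v z) * f v
                  = Num.max 0 (\sum_z c z * x z)
      & forall v, 0 <= f v].
Proof.
move=> Cx; have [xl0|xl_neq0] := eqVneq (x l) 0.
  (* Here [V l] may be empty, when [l] is the only zone. *)
  have x0 := exchange_cone_eq0 Cx xl0.
  exists (fun=> 0); split=> // [|z|c].
  - by rewrite (_ : [set _ | _] = set0)//; apply/seteqP; split=> v //=; rewrite eqxx.
  - by rewrite x0 fsbig1// => v _; rewrite mul0r.
  - rewrite fsbig1 => [|v _]; last by rewrite mulr0.
    by rewrite big1 ?maxxx// => z _; rewrite x0 mulr0.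
have t_ge0 : 0 <= - x l by case: Cx; rewrite oppr_ge0.
have t_neq0 : - x l != 0 by rewrite oppr_eq0.
pose v0 : @V R N l := SigSub (mem_set (exchange_cone_normalize Cx xl_neq0)).
have v0E z : - x l * val v0 z = x z by rewrite ffunE mulrC divfK.
pose f (v : @V R N l) := if v == v0 then - x l else 0.
have fsumf (g : @V R N l -> R) :
    \sum_(v \in [set: @V R N l]) f v * g v = - x l * g v0.
  rewrite -(@fsbig_widen _ _ _ _ [set v0] setT)// => [|v [_ /= /eqP vv0]].
    by rewrite fsbig_set1 /f eqxx.
  by rewrite /f (negPf vv0) mul0r.
exists f; split=> [|z|c|v].
- apply: sub_finite_set (finite_set1 v0) => v /=.
  by rewrite /f; case: (eqVneq v v0) => [|_]; rewrite ?eqxx.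
- by rewrite fsumf.
- under eq_fsbigr do rewrite mulrC.
  rewrite fsumf maxr_pMr// mulr0 mulr_sumr; congr Num.max.
  by apply: eq_bigr => z _; rewrite mulrCA v0E.
- by rewrite /f; case: ifP.
Qed.

Section Combination.
Variables (l : N) (f : @V R N l -> R).
Hypothesis finf : finite_set [set v | f v != 0].
Hypothesis f_ge0 : forall v, 0 <= f v.

Lemma exchange_cone_combination :
  exchange_cone l (fun z => \sum_(v \in [set: @V R N l]) f v * val v z).
Proof.
have Vv (v : @V R N l) : V l (val v) by apply: set_mem (valP v).
split=> [|z zl|].
- rewrite -oppr_ge0; have [s fsumE] := weighted_fsum_seq finf.
  rewrite fsumE -sumrN; apply: sumr_ge0 => v _.
  by case: (Vv v) => -> _ _; rewrite mulrN1 opprK.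
- by apply: fsumr_ge0 => v _; rewrite mulr_ge0//; case: (Vv v) => _ ->.
- have [s fsumE] := weighted_fsum_seq finf.
  under eq_bigr do rewrite fsumE.
  rewrite exchange_big big1// => v _.
  by rewrite -mulr_sumr; case: (Vv v) => _ _ ->; rewrite mulr0.
Qed.

Lemma flow_combination_le c :
  \sum_z c z * (\sum_(v \in [set: @V R N l]) f v * val v z) <=
  \sum_(v \in [set: @V R N l]) Num.max 0 (\sum_z c z * val v z) * f v.
Proof.
under [leRHS]eq_fsbigr do rewrite mulrC.
have [s fsumE] := weighted_fsum_seq finf.
rewrite fsumE; under eq_bigr do rewrite fsumE mulr_sumr.
rewrite exchange_big; apply: ler_sum => v _.
under eq_bigr do rewrite mulrCA.
by rewrite -mulr_sumr ler_wpM2l// le_max lexx orbT.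
Qed.

End Combination.

Section Projections.
Variables (CNE : finType) (PTDF : CNE -> N -> R) (F : CNE -> R).

Lemma combination_XFIBME nr f : XIBME PTDF F (nr, f) ->
  XFIBME PTDF F
    (nr, ((fun l z => \sum_(v \in [set: @V R N l]) f l v * val v z),
          (fun l k => \sum_(v \in [set: @V R N l])
                        Num.max 0 (\sum_z PTDF k z * val v z) * f l v))).
Proof.
case=> /(finite_set_sigT (fun l v => f l v != 0)) finf nrE capF f_ge0.
have cone l := exchange_cone_combination (finf l) (f_ge0 l).
split=> // [l|l k|]; first by case: (cone l).
  exact: (flow_combination_le (finf l) (f_ge0 l)).
split=> l; first by case: (cone l).
by move=> k; apply: fsumr_ge0 => v _; rewrite mulr_ge0// le_max lexx.
Qed.

Lemma ray_XIBME nr nrl w : XFIBME PTDF F (nr, (nrl, w)) ->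
  exists f, XIBME PTDF F (nr, f).
Proof.
case=> nrE sum0 flow_le cap_le [sgn w_ge0].
have cone l : exchange_cone l (nrl l) by case: (sgn l).
have /all_sig[f fP] l := cid (exchange_cone_ray (cone l)).
exists f; split.
- by apply/(finite_set_sigT (fun l v => f l v != 0)) => l; case: (fP l).
- by move=> z; rewrite nrE; apply: eq_bigr => l _; case: (fP l).
- move=> k; apply: le_trans (cap_le k); apply: ler_sum => l _.
  by case: (fP l) => _ _ -> _; rewrite ge_max w_ge0 flow_le.
- by move=> l; case: (fP l).
Qed.

Lemma Proj_nr_XIBME : Proj_nr (XIBME PTDF F) = Proj_nr (XFIBME PTDF F).
Proof.
apply/seteqP; split=> _ [[nr y] + <-] /=.
  by move=> /combination_XFIBME XF; eexists; first exact: XF.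
by case: y => nrl w /ray_XIBME[f Xf]; exists (nr, f).
Qed.

End Projections.
End ExchangeCone.

Theorem proposition6 (R : realType) (N CNE : finType)
    (PTDF : CNE -> N -> R) (F : CNE -> R) :
  (forall (B : Type) (obj : B * {ffun N -> R} -> R)
          (orderbook : set (B * {ffun N -> R})),
      equivalent_models (IBME PTDF F obj orderbook)
                        (FIBME PTDF F obj orderbook)) /\
  Proj_nr (XIBME PTDF F) = Proj_nr (XFIBME PTDF F).
Proof.
have projE := Proj_nr_XIBME PTDF F.
by split=> // B obj orderbook; split=> //=; rewrite projE.
Qed.
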